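(* Let $A_0,A_1\in\mathbb{R}^{n\times n}$ be symmetric matrices. Any local minimizer of the problem $$\min_{x\in\mathbb{R}^n}\{x^TA_0x:\ x^TA_1x=1\}$$ is a global minimizer of this problem.
   Context: A local minimizer of a constrained problem is a feasible point $x^*$ such that the objective value at $x^*$ is at most the objective value at every feasible point in some neighbourhood of $x^*$; a global minimizer is a feasible point with least objective value over the whole feasible set. *)

(* Defs.v *)
From HB Require Import structures.
From mathcomp Require Import all_boot all_order all_algebra.
From mathcomp Require Import classical_sets reals topology normedtype.

Set Implicit Arguments.
Unset Strict Implicit.
Unset Printing Implicit Defensive.

Import Order.TTheory GRing.Theory Num.Theory.
Import numFieldNormedType.Exports.

Local Open Scope classical_set_scope.
Local Open Scope ring_scope.

Definition quad_form (R : realType) (n : nat) (A : 'M[R]_n) (x : 'cV[R]_n) : R :=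
  (x^T *m A *m x) 0 0.

Definition local_minimizer (R : realType) (T : topologicalType)
    (f : T -> R) (D : set T) (x : T) : Prop :=
  D x /\ \forall y \near x, D y -> f x <= f y.

Definition global_minimizer (R : realType) (T : Type)
    (f : T -> R) (D : set T) (x : T) : Prop :=
  D x /\ forall y, D y -> f x <= f y.

(* Main.v *)
Require Import Defs.
From HB Require Import structures.
From mathcomp Require Import all_boot all_order all_algebra.
From mathcomp Require Import classical_sets reals topology normedtype.
From mathcomp Require Import realfun lra.

Set Implicit Arguments.
Unset Strict Implicit.
Unset Printing Implicit Defensive.

Import Order.TTheory GRing.Theory Num.Theory.
Import numFieldNormedType.Exports.

Local Open Scope classical_set_scope.
Local Open Scope ring_scope.

(** Write [q0], [q1] for the two quadratic forms and put [q z = q0 z - q0 x * q1 z].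
    Both forms are homogeneous of degree 2, so a point [z] close to [x], where
    [q1 z > 0] by continuity, can be rescaled onto the constraint set while
    staying close to [x]. The constrained local minimality of [x] thus becomes
    an unconstrained one: [q >= 0 = q x] in a whole neighbourhood of [x]
    ([local_minimizer_homogenize]).

    A quadratic form with an unconstrained local minimum of value 0 is
    nonnegative everywhere: for small [t] the parallelogram law gives
    [0 <= q (x + t y) + q (x - t y) = 2 (q x + t^2 q y) = 2 t^2 q y].
    For a feasible [y], where [q1 y = 1], the inequality [0 <= q y] is
    [q0 x <= q0 y]. *)

Lemma quad_formE (R : realType) n (A : 'M[R]_n) (x : 'cV[R]_n) :
  quad_form A x = \sum_j (\sum_i x i 0 * A i j) * x j 0.
Proof.
rewrite /quad_form mxE; apply: eq_bigr => j _; rewrite mxE; congr (_ * _).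
by apply: eq_bigr => i _; rewrite mxE.
Qed.

Lemma quad_formZ (R : realType) n (A : 'M[R]_n) a (x : 'cV[R]_n) :
  quad_form A (a *: x) = a ^+ 2 * quad_form A x.
Proof.
rewrite /quad_form.
have -> : (a *: x)^T = a *: x^T by apply/matrixP => i j; rewrite !mxE.
by rewrite -!scalemxAl -scalemxAr scalerA mxE expr2.
Qed.

(** The sum over [x + y] and [x - y] cancels the terms of first order in [y],
    so that nonnegativity near a point can be tested without a first-order
    optimality condition. *)
Lemma quad_form_parallelogram (R : realType) n (A : 'M[R]_n) (x y : 'cV[R]_n) :
  quad_form A (x + y) + quad_form A (x - y)
  = 2 * (quad_form A x + quad_form A y).
Proof.
rewrite /quad_form !linearD !linearN /= !(mulmxDl, mulmxDr, mulmxN, mulNmx).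
rewrite !mxE; lra.
Qed.

Lemma quad_form_continuous (R : realType) n (A : 'M[R]_n) :
  continuous (quad_form A).
Proof.
have cont_row j : continuous (fun z : 'cV[R]_n => \sum_i z i 0 * A i j).
  apply: (continuous_big add_continuous) => i _ z.
  by apply: continuousM; [exact: coord_continuous|exact: cst_continuous].
have cont_sum : continuous (fun z : 'cV[R]_n =>
    \sum_j (\sum_i z i 0 * A i j) * z j 0).
  apply: (continuous_big add_continuous) => j _ z.
  by apply: continuousM; [exact: cont_row|exact: coord_continuous].
move=> x; rewrite /continuous_at quad_formE.
by under eq_cvg do rewrite quad_formE; exact: cont_sum.
Qed.

(** For [z] near [x] the normalised point [z / sqrt (q1 z)] is feasible and near
    [x], so its value [q0 z / q1 z] is at least [q0 x]; clearing the denominator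
    leaves an inequality free of the constraint. *)
Lemma local_minimizer_homogenize (R : realType) n (A0 A1 : 'M[R]_n)
    (x : 'cV[R]_n) :
  local_minimizer (quad_form A0) [set y | quad_form A1 y = 1] x ->
  \forall z \near x, quad_form A0 x * quad_form A1 z <= quad_form A0 z.
Proof.
case=> /= q1x xmin.
pose g (z : 'cV[R]_n) := (Num.sqrt (quad_form A1 z))^-1 *: z.
have gx : g x = x by rewrite /g q1x sqrtr1 invr1 scale1r.
have g_cont : {for x, continuous g}.
  apply: continuousZ; last exact: cvg_id.
  apply: continuousV; first by rewrite q1x sqrtr1 oner_neq0.
  apply: continuous_comp; first exact: quad_form_continuous.
  exact: sqrt_continuous.
have q1pos : \forall z \near x, 0 < quad_form A1 z.
  by apply: (cvgr_gt _ (@quad_form_continuous R n A1 x)); rewrite q1x ltr01.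
have gmin : \forall z \near x,
    quad_form A1 (g z) = 1 -> quad_form A0 x <= quad_form A0 (g z).
  by move: g_cont; rewrite /prop_for /continuous_at gx => /(_ _ xmin).
near=> z.
have z0 : 0 < quad_form A1 z by near: z.
have qg A : quad_form A (g z) = quad_form A z / quad_form A1 z.
  by rewrite quad_formZ exprVn sqr_sqrtr 1?ltW // mulrC.
have : quad_form A1 (g z) = 1 -> quad_form A0 x <= quad_form A0 (g z).
  by near: z; exact: gmin.
rewrite !qg ler_pdivlMr // => -> //.
by rewrite divff // gt_eqF.
Unshelve. all: by end_near. Qed.

Theorem theorem3p2 (R : realType) (n : nat) (A0 A1 : 'M[R]_n)
    (A0_sym : A0^T = A0) (A1_sym : A1^T = A1) (x : 'cV[R]_n) :
  local_minimizer (quad_form A0) [set y | quad_form A1 y = 1] x ->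
  global_minimizer (quad_form A0) [set y | quad_form A1 y = 1] x.
Proof.
move=> xmin; have q1x := xmin.1; split=> // y /= q1y.
have xline : x + t *: y @[t --> (0 : R)] --> x.
  rewrite -[X in _ --> X]addr0 -(scale0r y).
  by apply: cvgD; [exact: cvg_cst|apply: cvgZr_tmp; exact: cvg_id].
(* A ball around 0 is symmetric, so it holds a parameter and its opposite. *)
have /nbhs_ballP[e /= e0 He] := xline _ (local_minimizer_homogenize xmin).
pose t := e / 2; have t0 : 0 < t by rewrite divr_gt0.
have t_lt_e : t < e by rewrite /t; lra.
have ge_t : quad_form A0 x * quad_form A1 (x + t *: y)
    <= quad_form A0 (x + t *: y).
  by apply: He; rewrite -ball_normE /= sub0r normrN gtr0_norm.
have ge_Nt : quad_form A0 x * quad_form A1 (x - t *: y)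
    <= quad_form A0 (x - t *: y).
  by rewrite -scaleNr; apply: He; rewrite -ball_normE /= sub0r opprK gtr0_norm.
have := lerD ge_t ge_Nt.
rewrite -mulrDr !quad_form_parallelogram !quad_formZ q1x q1y => sum_le.
by rewrite -(ler_pM2l (exprn_gt0 2 t0)); move: sum_le; lra.
Qed.
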